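(* Let $K$ be a positive integer and let $m,\ell$ be integers with $0\le \ell\le 2K$ and $m\equiv \ell \pmod 2$. Then, for each choice of sign, \[ C_{m,\ell}^{2K}(q)\pm C_{2K-m,\ell}^{2K}(q) =\frac{q^{s(m,\ell,2K)}}{J_{1}^3}\Big ( f_{K+1,K+1,1}\big(\pm q^{1+\frac{1}{2}(K+\ell)},q^{1+\frac{1}{2}(m+\ell)},q\big) \pm q^{\frac{1}{2}(K-\ell)}f_{K+1,K+1,1}\big(\pm q^{1+\frac{1}{2}(3K-\ell)},q^{1+K+\frac{1}{2}(m-\ell)},q\big)\Big), \] where the sign $\pm$ is the same in all three places.
   Context: Let $q=e^{2\pi i\tau}$ with $\operatorname{Im}\tau>0$, and for real $\alpha$ put $q^{\alpha}:=e^{2\pi i\alpha\tau}$. For $x\in\mathbb{C}^*$, $j(x;q):=\sum_{n\in\mathbb{Z}}(-1)^nq^{n(n-1)/2}x^n$, and $J_1:=\prod_{i\ge1}(1-q^i)$. For positive integers $a,b,c$ and $x,y\in\mathbb{C}^*$, the Hecke-type double-sum is $f_{a,b,c}(x,y,q):=\Big(\sum_{r,s\ge0}-\sum_{r,s<0}\Big)(-1)^{r+s}x^ry^sq^{a\binom{r}{2}+brs+c\binom{s}{2}}$. For a positive integer $N$ and integers $m,\ell$ with $0\le\ell\le N$, $m\equiv\ell\pmod 2$, put $s(m,\ell,N):=-\frac18+\frac{(\ell+1)^2}{4(N+2)}-\frac{m^2}{4N}$. The level-$N$ $A_1^{(1)}$ string function is given by the Hecke-type expression $C_{m,\ell}^{N}(q)=\dfrac{q^{s(m,\ell,N)}}{J_1^3}\,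 f_{1,1+N,1}\big(q^{1+\frac12(m+\ell)},q^{1-\frac12(m-\ell)},q\big)$ (this may be taken as the definition of $C^N_{m,\ell}$). *)

(* Defs.v *)
From Stdlib Require Import Reals ZArith.
From Coquelicot Require Import Coquelicot.
Open Scope R_scope.

Definition cexp (z : C) : C :=
  (exp (Re z) * cos (Im z), exp (Re z) * sin (Im z)).

Definition qpow (tau : C) (alpha : R) : C :=
  cexp (Cmult (RtoC (2 * PI * alpha)) (Cmult Ci tau)).

Fixpoint cpow (x : C) (n : nat) : C :=
  match n with O => RtoC 1 | S n => Cmult x (cpow x n) end.
Definition zpow (x : C) (n : Z) : C :=
  match n with
  | Z0 => RtoC 1
  | Zpos p => cpow x (Pos.to_nat p)
  | Zneg p => Cinv (cpow x (Pos.to_nat p))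
  end.

(* binomial (r choose 2) = r(r-1)/2 for integer r (exact division) *)
Definition binZ2 (r : Z) : Z := (r * (r - 1) / 2)%Z.

(* sum over N x N of a complex double sequence, as iterated series of real
   and imaginary parts (the series used below converge absolutely) *)
Definition csum2 (F : nat -> nat -> C) : C :=
  (Series (fun i => Series (fun j => Re (F i j))),
   Series (fun i => Series (fun j => Im (F i j)))).

Definition hecke_term (a b c : Z) (x y tau : C) (r s : Z) : C :=
  Cmult (Cmult (Cmult (zpow (RtoC (-1)) (r + s)) (zpow x r)) (zpow y s))
        (qpow tau (IZR (a * binZ2 r + b * r * s + c * binZ2 s))).

Definition hecke (a b c : Z) (x y tau : C) : C :=
  Cminus
    (csum2 (fun i j => hecke_term a b c x y tau (Z.of_nat i) (Z.of_nat j)))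
    (csum2 (fun i j => hecke_term a b c x y tau
                          (-1 - Z.of_nat i)%Z (-1 - Z.of_nat j)%Z)).

Fixpoint J1_partial (tau : C) (n : nat) : C :=
  match n with
  | O => RtoC 1
  | S k => Cmult (J1_partial tau k) (Cminus (RtoC 1) (qpow tau (INR (S k))))
  end.
Definition J1 (tau : C) : C :=
  (real (Lim_seq (fun n => Re (J1_partial tau n))),
   real (Lim_seq (fun n => Im (J1_partial tau n)))).

Definition sML (m l : Z) (N : nat) : R :=
  - / 8 + (IZR l + 1) ^ 2 / (4 * (INR N + 2)) - (IZR m) ^ 2 / (4 * INR N).

Definition string_fn (N : nat) (m l : Z) (tau : C) : C :=
  Cmult (Cdiv (qpow tau (sML m l N)) (cpow (J1 tau) 3))
        (hecke 1 (1 + Z.of_nat N) 1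
               (qpow tau (1 + (IZR m + IZR l) / 2))
               (qpow tau (1 - (IZR m - IZR l) / 2)) tau).

Definition sgnC (b : bool) : C := if b then RtoC 1 else RtoC (-1).

(* Main.v *)
Require Import Defs.
From Stdlib Require Import Reals ZArith Lra Lia Bool.
From Coquelicot Require Import Coquelicot.
Open Scope R_scope.

(* The substitution (r, s) -> (r + s, r), suitably reflected, turns the even
   and odd [r]-slices of the two sums on the right into pieces of the two sums
   on the left, with equal terms. Put m' = 2K - m and let T1, T2 be the terms
   of the string functions for m, m' (T2 including the factor
   +-q^((m-K)/2)). The even slices of the first right-hand sum and the odd
   slices of the second fill the cones r >= s and r < s (mirrored in the third
   quadrant) of T1. The remaining slices fill the range of T2, except that the
   row r = 0 is counted with s < 0, negatively, instead of s >= 0; the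
   difference is the bilateral theta sum j(q^k; q) with k an integer, which
   vanishes. All rearrangements are of absolutely convergent double series. *)

(** * Real series: comparison and splitting by the parity of the index *)

Lemma ex_series_le_R (a b : nat -> R) :
  (forall n, Rabs (a n) <= b n) -> ex_series b -> ex_series a.
Proof. exact (ex_series_le (K := R_AbsRing) (V := R_CompleteNormedModule) a b). Qed.

Lemma ex_series_mult_l (c : R) (a : nat -> R) :
  ex_series a -> ex_series (fun n => c * a n).
Proof. exact (ex_series_scal_l (K := R_AbsRing) (V := R_NormedModule) c a). Qed.

Lemma Rabs_Series_le (a b : nat -> R) :
  (forall n, Rabs (a n) <= b n) -> ex_series b -> Rabs (Series a) <= Series b.
Proof.
  intros Hab Hb.
  eapply Rle_trans.
  - apply Series_Rabs. apply ex_series_le_R with b; [|exact Hb].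
    intros n. rewrite Rabs_Rabsolu. apply Hab.
  - apply Series_le; [|exact Hb]. intros n. split; [apply Rabs_pos | apply Hab].
Qed.

(** The partial sums of the paired series are the partial sums of [a] at the odd indices
    [2 * n + 1], a subsequence with the same limit. *)
Lemma is_series_pairs (a : nat -> R) (s : R) :
  is_series a s -> is_series (fun n => a (2 * n)%nat + a (2 * n + 1)%nat) s.
Proof.
  intros Ha.
  change (is_lim_seq (sum_n (fun n => a (2 * n)%nat + a (2 * n + 1)%nat)) s).
  apply is_lim_seq_ext with (fun n => sum_n a (2 * n + 1)).
  - induction n as [|n IH].
    + cbn [Nat.mul Nat.add]. now rewrite sum_Sn, !sum_O.
    + replace (2 * S n + 1)%nat with (S (S (2 * n + 1))) by lia.
      rewrite !sum_Sn, IH.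
      replace (S (2 * n + 1)) with (2 * S n)%nat by lia.
      replace (S (2 * S n)) with (2 * S n + 1)%nat by lia.
      unfold plus; simpl; ring.
  - apply (is_lim_seq_subseq (sum_n a) s (fun n => (2 * n + 1)%nat)); [|exact Ha].
    apply eventually_subseq. intros n. lia.
Qed.

Lemma Series_even_odd (a : nat -> R) :
  ex_series (fun n => Rabs (a n)) ->
  Series a = Series (fun n => a (2 * n)%nat) + Series (fun n => a (2 * n + 1)%nat).
Proof.
  intros Ha.
  (* Either subseries converges because pairing up the terms of [a] with the
     other parity replaced by zero gives it back. *)
  assert (Hodd : forall n, Nat.even (2 * n + 1) = false).
  { intros n. now rewrite Nat.even_add, Nat.even_mul. }
  assert (Heven : forall n, Nat.even (2 * n) = true).
  { intros n. now rewrite Nat.even_mul. }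
  assert (He : ex_series (fun n => a (2 * n)%nat)).
  { set (h n := if Nat.even n then a n else 0).
    assert (Hh : ex_series h).
    { apply ex_series_le_R with (fun n => Rabs (a n)); [|exact Ha].
      intros n. unfold h. destruct (Nat.even n); [lra|].
      rewrite Rabs_R0. apply Rabs_pos. }
    destruct Hh as [s Hs]. exists s.
    refine (is_series_ext _ _ _ _ (is_series_pairs h s Hs)).
    intros n. unfold h. rewrite Heven, Hodd. apply Rplus_0_r. }
  assert (Ho : ex_series (fun n => a (2 * n + 1)%nat)).
  { set (h n := if Nat.even n then 0 else a n).
    assert (Hh : ex_series h).
    { apply ex_series_le_R with (fun n => Rabs (a n)); [|exact Ha].
      intros n. unfold h. destruct (Nat.even n); [|lra].
      rewrite Rabs_R0. apply Rabs_pos. }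
    destruct Hh as [s Hs]. exists s.
    refine (is_series_ext _ _ _ _ (is_series_pairs h s Hs)).
    intros n. unfold h. rewrite Heven, Hodd. apply Rplus_0_l. }
  rewrite <- Series_plus by assumption.
  symmetry. apply is_series_unique, is_series_pairs, Series_correct.
  now apply ex_series_Rabs.
Qed.

(** * Rearrangement of real double series *)

(** A summable bound in product form is symmetric in the two indices and survives shifts. It gives
    convergence of the rows, of the columns and of the series of their sums, and the Hecke terms
    obey such a bound with Gaussian factors. *)
Definition dominated (f : nat -> nat -> R) : Prop :=
  exists a b : nat -> R, ex_series a /\ ex_series b /\
    forall i j, Rabs (f i j) <= a i * b j.

Lemma dominated_le (f g : nat -> nat -> R) :
  (forall i j, Rabs (f i j) <= Rabs (g i j)) -> dominated g -> dominated f.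
Proof.
  intros Hfg (a & b & Ha & Hb & Hg). exists a, b. repeat split; trivial.
  intros i j. eapply Rle_trans; [apply Hfg | apply Hg].
Qed.

Lemma dominated_swap (f : nat -> nat -> R) :
  dominated f -> dominated (fun i j => f j i).
Proof.
  intros (a & b & Ha & Hb & Hf). exists b, a. repeat split; trivial.
  intros i j. rewrite Rmult_comm. apply Hf.
Qed.

Lemma dominated_shift (f : nat -> nat -> R) :
  dominated f -> dominated (fun i j => f (S i) j).
Proof.
  intros (a & b & Ha & Hb & Hf). exists (fun i => a (S i)), b.
  repeat split; trivial.
  apply (ex_series_incr_1 (K := R_AbsRing) (V := R_NormedModule) a), Ha.
Qed.

Lemma dominated_ex_inner (f : nat -> nat -> R) (i : nat) :
  dominated f -> ex_series (f i).
Proof.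
  intros (a & b & Ha & Hb & Hf).
  apply ex_series_le_R with (fun j => a i * b j); [apply Hf|].
  now apply ex_series_mult_l.
Qed.

Lemma dominated_ex_outer (f : nat -> nat -> R) :
  dominated f -> ex_series (fun i => Rabs (Series (f i))).
Proof.
  intros (a & b & Ha & Hb & Hf).
  apply ex_series_le_R with (fun i => Series b * a i).
  - intros i. rewrite Rabs_Rabsolu, Rmult_comm, <- Series_scal_l.
    apply Rabs_Series_le; [apply Hf | now apply ex_series_mult_l].
  - now apply ex_series_mult_l.
Qed.

Lemma Rabs_Series2_le (f : nat -> nat -> R) (a b : nat -> R) :
  ex_series a -> ex_series b -> (forall i j, Rabs (f i j) <= a i * b j) ->
  Rabs (Series (fun i => Series (f i))) <= Series a * Series b.
Proof.
  intros Ha Hb Hf.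
  rewrite <- Series_scal_r. apply Rabs_Series_le.
  - intros i. rewrite <- Series_scal_l.
    apply Rabs_Series_le; [apply Hf | now apply ex_series_mult_l].
  - apply (ex_series_ext (fun i => Series b * a i)).
    + intros i. apply Rmult_comm.
    + now apply ex_series_mult_l.
Qed.

Lemma Series2_first_row (f : nat -> nat -> R) :
  dominated f ->
  Series (fun i => Series (f i)) =
  Series (f O) + Series (fun i => Series (f (S i))).
Proof.
  intros Hf. apply (Series_incr_1 (fun i => Series (f i))).
  now apply ex_series_Rabs, dominated_ex_outer.
Qed.

(** The index [i] is summed inside here, so its term at zero is removed from every inner series at
    once. This is the inductive step of the Fubini argument in [Series_swap]. *)
Lemma Series2_first_column (f : nat -> nat -> R) :
  dominated f ->
  Series (fun j => Series (fun i => f i j)) =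
  Series (f O) + Series (fun j => Series (fun i => f (S i) j)).
Proof.
  intros Hf. rewrite <- Series_plus.
  - apply Series_ext. intros j.
    apply (Series_incr_1 (fun i => f i j)).
    exact (dominated_ex_inner _ j (dominated_swap _ Hf)).
  - now apply dominated_ex_inner.
  - apply ex_series_Rabs.
    exact (dominated_ex_outer _ (dominated_swap _ (dominated_shift _ Hf))).
Qed.

Lemma dominated_shift_n (n : nat) (f : nat -> nat -> R) :
  dominated f -> dominated (fun i j => f (n + i)%nat j).
Proof.
  intros Hf. induction n as [|n IH]; [exact Hf|].
  apply dominated_shift in IH. revert IH. apply dominated_le.
  intros i j. replace (n + S i)%nat with (S n + i)%nat by lia. lra.
Qed.

Lemma ex_series_shift_n (n : nat) (a : nat -> R) :
  ex_series a -> ex_series (fun i => a (n + i)%nat).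
Proof. apply (ex_series_incr_n (K := R_AbsRing) (V := R_NormedModule)). Qed.

(** Fubini by tails: the first [n + 1] row sums differ from the sum in the other order by [rest n],
    which is at most [Series b] times a tail of [a] and so tends to zero. *)
Lemma Series_swap (f : nat -> nat -> R) :
  dominated f ->
  Series (fun i => Series (f i)) = Series (fun j => Series (fun i => f i j)).
Proof.
  intros Hf.
  set (rest n := Series (fun j => Series (fun i => f (S n + i)%nat j))).
  set (total := Series (fun j => Series (fun i => f i j))).
  assert (Hpartial : forall n, sum_n (fun i => Series (f i)) n = total - rest n).
  { induction n as [|n IH].
    - rewrite sum_O. unfold total, rest.
      rewrite (Series2_first_column f Hf). simpl. ring.
    - rewrite sum_Sn, IH. unfold rest.
      rewrite (Series2_first_column _ (dominated_shift_n (S n) f Hf)).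
      rewrite Nat.add_0_r.
      replace (Series (fun j => Series (fun i => f (S n + S i)%nat j)))
        with (Series (fun j => Series (fun i => f (S (S n) + i)%nat j))).
      + unfold plus; simpl.
        change (Series (fun j => f (S n) j)) with (Series (f (S n))). ring.
      + apply Series_ext; intros j; apply Series_ext; intros i.
        f_equal; lia. }
  destruct Hf as (a & b & Ha & Hb & Hf).
  assert (Htail : is_lim_seq (fun n => Series (fun i => a (S n + i)%nat)) 0).
  { apply is_lim_seq_ext with (fun n => Series a - sum_n a n).
    - intros n. rewrite (Series_incr_n a (S n)) by (trivial; lia).
      rewrite sum_n_Reals. simpl. ring.
    - replace (Finite 0) with (Finite (Series a - Series a)) by (f_equal; ring).
      apply is_lim_seq_minus'; [apply is_lim_seq_const|].
      now apply Series_correct. }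
  assert (Hrest : is_lim_seq rest 0).
  { apply is_lim_seq_abs_0.
    apply is_lim_seq_le_le with
      (fun _ => 0) (fun n => Series b * Series (fun i => a (S n + i)%nat)).
    - intros n. split; [apply Rabs_pos|].
      apply (Rabs_Series2_le (fun j i => f (S n + i)%nat j) b
               (fun i => a (S n + i)%nat)); trivial.
      + now apply ex_series_shift_n.
      + intros i j. rewrite Rmult_comm. apply Hf.
    - apply is_lim_seq_const.
    - replace (Finite 0) with (Rbar_mult (Series b) 0) by (simpl; f_equal; ring).
      now apply is_lim_seq_scal_l. }
  apply is_series_unique.
  change (is_lim_seq (sum_n (fun i => Series (f i))) total).
  apply is_lim_seq_ext with (fun n => total - rest n); [now intros n|].
  replace (Finite total) with (Finite (total - 0)) by (f_equal; ring).
  apply is_lim_seq_minus'; [apply is_lim_seq_const | exact Hrest].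
Qed.

(** Both triangles are extended by zero to the whole quadrant, which preserves domination. The
    diagonal itself belongs to the lower one. *)
Lemma Series2_diagonal (f : nat -> nat -> R) :
  dominated f ->
  Series (fun i => Series (f i)) =
  Series (fun i => Series (fun j => f (i + j)%nat i)) +
  Series (fun i => Series (fun j => f i (i + j + 1)%nat)).
Proof.
  intros Hf.
  set (lo i j := if (j <=? i)%nat then f i j else 0).
  set (up i j := if (j <=? i)%nat then 0 else f i j).
  assert (Hlo : dominated lo).
  { revert Hf. apply dominated_le. intros i j. unfold lo.
    destruct (j <=? i)%nat; [lra|]. rewrite Rabs_R0. apply Rabs_pos. }
  assert (Hup : dominated up).
  { revert Hf. apply dominated_le. intros i j. unfold up.
    destruct (j <=? i)%nat; [|lra]. rewrite Rabs_R0. apply Rabs_pos. }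
  transitivity (Series (fun i => Series (lo i)) + Series (fun i => Series (up i))).
  - rewrite <- Series_plus by now apply ex_series_Rabs, dominated_ex_outer.
    apply Series_ext. intros i.
    rewrite <- Series_plus by now apply dominated_ex_inner.
    apply Series_ext. intros j. unfold lo, up.
    destruct (j <=? i)%nat; ring.
  (* After the swap the lower triangle is summed by columns, and column [i] starts at row [i]; row
     [i] of the upper triangle starts at column [i + 1]. The zeros before these starts are
     dropped. *)
  - rewrite (Series_swap lo Hlo). f_equal; apply Series_ext; intros i.
    + rewrite (Series_incr_n_aux _ i).
      * apply Series_ext. intros j. unfold lo.
        now rewrite (proj2 (Nat.leb_le i (i + j))) by lia.
      * intros j Hj. unfold lo. now rewrite (proj2 (Nat.leb_gt i j)).
    + rewrite (Series_incr_n_aux _ (S i)).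
      * apply Series_ext. intros j. unfold up.
        rewrite (proj2 (Nat.leb_gt (S i + j) i)) by lia. f_equal; lia.
      * intros j Hj. unfold up.
        now rewrite (proj2 (Nat.leb_le j i)) by lia.
Qed.

(** * Bilateral series and their cancellation *)

Lemma ex_series_ray (g : Z -> R) (x : Z) :
  ex_series (fun n => g (x + Z.of_nat n)%Z) <->
  ex_series (fun n => g (x + 1 + Z.of_nat n)%Z).
Proof.
  rewrite (ex_series_incr_1 (K := R_AbsRing) (V := R_NormedModule)).
  split; apply ex_series_ext; intros n; f_equal; lia.
Qed.

Lemma Series_ray (g : Z -> R) (x : Z) :
  ex_series (fun n => g (x + Z.of_nat n)%Z) ->
  Series (fun n => g (x + Z.of_nat n)%Z) =
  g x + Series (fun n => g (x + 1 + Z.of_nat n)%Z).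
Proof.
  intros Hg. rewrite Series_incr_1 by exact Hg. f_equal.
  - f_equal. lia.
  - apply Series_ext. intros n. f_equal. lia.
Qed.

(** Moving the cut between the two rays by one hands a single term from one ray to the other. The
    induction on [k] goes in both directions and carries the convergence of both rays along. *)
Lemma bilateral_Series_shift (h : Z -> R) (k : Z) :
  ex_series (fun n => h (0 + Z.of_nat n)%Z) ->
  ex_series (fun n => h (- (1 + Z.of_nat n))%Z) ->
  Series (fun n => h (k + Z.of_nat n)%Z) +
  Series (fun n => h (- (1 - k + Z.of_nat n))%Z) =
  Series (fun n => h (0 + Z.of_nat n)%Z) +
  Series (fun n => h (- (1 + Z.of_nat n))%Z).
Proof.
  intros Hp Hn.
  (* Reflection turns the descending ray into an ascending one, so that the two ray lemmas serve
     both halves. *)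
  set (h' x := h (- x)%Z).
  enough (H : ex_series (fun n => h (k + Z.of_nat n)%Z) /\
    ex_series (fun n => h' (1 - k + Z.of_nat n)%Z) /\
    Series (fun n => h (k + Z.of_nat n)%Z) +
    Series (fun n => h' (1 - k + Z.of_nat n)%Z) =
    Series (fun n => h (0 + Z.of_nat n)%Z) +
    Series (fun n => h' (1 + Z.of_nat n)%Z)) by apply H.
  induction k as [|k (Hr & Hl & IH)|k (Hr & Hl & IH)] using Z.peano_ind.
  - auto.
  - pose proof (ex_series_ray h' (- k)) as Hex.
    pose proof (Series_ray h' (- k)) as Hsum.
    replace (- k + 1)%Z with (1 - k)%Z in * by lia.
    replace (1 - Z.succ k)%Z with (- k)%Z by lia.
    replace (Z.succ k) with (k + 1)%Z by lia.
    rewrite (Series_ray h k Hr) in IH.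
    repeat split.
    + exact (proj1 (ex_series_ray h k) Hr).
    + now apply Hex.
    + rewrite <- IH, Hsum by now apply Hex.
      unfold h' at 1. rewrite Z.opp_involutive. ring.
  - pose proof (ex_series_ray h (Z.pred k)) as Hex.
    pose proof (Series_ray h (Z.pred k)) as Hsum.
    replace (Z.pred k + 1)%Z with k in * by lia.
    replace (1 - Z.pred k)%Z with (1 - k + 1)%Z by lia.
    rewrite (Series_ray h' (1 - k) Hl) in IH.
    repeat split.
    + now apply Hex.
    + exact (proj1 (ex_series_ray h' (1 - k)) Hl).
    + rewrite <- IH, Hsum by now apply Hex.
      unfold h' at 2. replace (- (1 - k))%Z with (Z.pred k) by lia. ring.
Qed.

(* The terms at [s] and [-1-2n-s] cancel; shifting the summation by [n] makes
   this pairing match the two halves [s >= 0] and [s < 0]. *)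
Lemma bilateral_Series_antisymmetric (h : Z -> R) (n : Z) :
  (forall s, h (-1 - 2 * n - s)%Z = - h s) ->
  ex_series (fun j => h (Z.of_nat j)) ->
  ex_series (fun j => h (-1 - Z.of_nat j)%Z) ->
  Series (fun j => h (Z.of_nat j)) + Series (fun j => h (-1 - Z.of_nat j)%Z) = 0.
Proof.
  intros Hanti Hp Hn.
  assert (E : forall j, (-1 - Z.of_nat j = - (1 + Z.of_nat j))%Z) by lia.
  rewrite (Series_ext (fun j => h (-1 - Z.of_nat j)%Z)
             (fun j => h (- (1 + Z.of_nat j))%Z))
    by now intros j; rewrite E.
  apply (ex_series_ext _ (fun j => h (- (1 + Z.of_nat j))%Z)) in Hn;
    [|now intros j; rewrite E].
  transitivity (Series (fun j => h (- n + Z.of_nat j)%Z) +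
                Series (fun j => h (- (1 - - n + Z.of_nat j))%Z)).
  - symmetry. exact (bilateral_Series_shift h (- n) Hp Hn).
  - rewrite (Series_ext (fun j => h (- (1 - - n + Z.of_nat j))%Z)
               (fun j => - h (- n + Z.of_nat j)%Z)).
    + rewrite Series_opp. ring.
    + intros j. rewrite <- Hanti. f_equal. lia.
Qed.

(** * Complex double sums, treated by real and imaginary parts *)

Definition csum (F : nat -> C) : C :=
  (Series (fun j => Re (F j)), Series (fun j => Im (F j))).

Definition cdominated (F : nat -> nat -> C) : Prop :=
  dominated (fun i j => Cmod (F i j)).

Lemma Rabs_Re_le_Cmod (z : C) : Rabs (Re z) <= Cmod z.
Proof. eapply Rle_trans; [apply Rmax_l | apply Rmax_Cmod]. Qed.

Lemma Rabs_Im_le_Cmod (z : C) : Rabs (Im z) <= Cmod z.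
Proof. eapply Rle_trans; [apply Rmax_r | apply Rmax_Cmod]. Qed.

Lemma cdominated_Re (F : nat -> nat -> C) :
  cdominated F -> dominated (fun i j => Re (F i j)).
Proof.
  apply dominated_le. intros i j.
  rewrite (Rabs_pos_eq (Cmod _)) by apply Cmod_ge_0. apply Rabs_Re_le_Cmod.
Qed.

Lemma cdominated_Im (F : nat -> nat -> C) :
  cdominated F -> dominated (fun i j => Im (F i j)).
Proof.
  apply dominated_le. intros i j.
  rewrite (Rabs_pos_eq (Cmod _)) by apply Cmod_ge_0. apply Rabs_Im_le_Cmod.
Qed.

Lemma cdominated_ext (F G : nat -> nat -> C) :
  (forall i j, F i j = G i j) -> cdominated F -> cdominated G.
Proof. intros H. apply dominated_le. intros i j. rewrite H. lra. Qed.

Lemma cdominated_scal (c : C) (F : nat -> nat -> C) :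
  cdominated F -> cdominated (fun i j => Cmult c (F i j)).
Proof.
  intros (a & b & Ha & Hb & HF).
  exists (fun i => Cmod c * a i), b. repeat split; trivial.
  - now apply ex_series_mult_l.
  - intros i j. rewrite Cmod_mult, Rabs_mult, Rmult_assoc.
    rewrite (Rabs_pos_eq (Cmod c)) by apply Cmod_ge_0.
    apply Rmult_le_compat_l; [apply Cmod_ge_0 | apply HF].
Qed.

Lemma csum2_ext (F G : nat -> nat -> C) :
  (forall i j, F i j = G i j) -> csum2 F = csum2 G.
Proof.
  intros H. unfold csum2.
  f_equal; apply Series_ext; intros i; apply Series_ext; intros j; now rewrite H.
Qed.

Lemma csum2_opp (F : nat -> nat -> C) :
  csum2 (fun i j => Copp (F i j)) = Copp (csum2 F).
Proof.
  unfold csum2, Copp; simpl.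
  f_equal; rewrite <- Series_opp; apply Series_ext; intros i; apply Series_opp.
Qed.

(** Stated for two sequences because each component of a complex multiple mixes the real and the
    imaginary part. *)
Lemma Series2_lincomb (u v : R) (f g : nat -> nat -> R) :
  dominated f -> dominated g ->
  Series (fun i => Series (fun j => u * f i j + v * g i j)) =
  u * Series (fun i => Series (f i)) + v * Series (fun i => Series (g i)).
Proof.
  intros Hf Hg. rewrite <- !Series_scal_l, <- Series_plus.
  - apply Series_ext. intros i. rewrite <- !Series_scal_l.
    apply Series_plus; apply ex_series_mult_l; now apply dominated_ex_inner.
  - apply ex_series_mult_l. now apply ex_series_Rabs, dominated_ex_outer.
  - apply ex_series_mult_l. now apply ex_series_Rabs, dominated_ex_outer.
Qed.

Lemma csum2_scal (c : C) (F : nat -> nat -> C) :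
  cdominated F -> csum2 (fun i j => Cmult c (F i j)) = Cmult c (csum2 F).
Proof.
  intros HF.
  pose proof (cdominated_Re F HF) as Hre. pose proof (cdominated_Im F HF) as Him.
  destruct c as [u v]. unfold csum2, Cmult; simpl. f_equal.
  - transitivity (u * Series (fun i => Series (fun j => Re (F i j))) +
                  - v * Series (fun i => Series (fun j => Im (F i j)))); [|ring].
    rewrite <- Series2_lincomb by trivial.
    apply Series_ext; intros i; apply Series_ext; intros j; unfold Re, Im; ring.
  - rewrite <- Series2_lincomb by trivial.
    apply Series_ext; intros i; apply Series_ext; intros j; unfold Re, Im; ring.
Qed.

Lemma csum2_even_odd (F : nat -> nat -> C) :
  cdominated F ->
  csum2 F = Cplus (csum2 (fun i j => F (2 * i)%nat j))
                  (csum2 (fun i j => F (2 * i + 1)%nat j)).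
Proof.
  intros HF. unfold csum2, Cplus; simpl fst; simpl snd. f_equal.
  - apply (Series_even_odd (fun i => Series (fun j => Re (F i j)))).
    exact (dominated_ex_outer _ (cdominated_Re F HF)).
  - apply (Series_even_odd (fun i => Series (fun j => Im (F i j)))).
    exact (dominated_ex_outer _ (cdominated_Im F HF)).
Qed.

Lemma csum2_first_row (F : nat -> nat -> C) :
  cdominated F -> csum2 F = Cplus (csum (F O)) (csum2 (fun i => F (S i))).
Proof.
  intros HF. unfold csum2, csum, Cplus; simpl fst; simpl snd. f_equal.
  - exact (Series2_first_row _ (cdominated_Re F HF)).
  - exact (Series2_first_row _ (cdominated_Im F HF)).
Qed.

Lemma csum2_swap (F : nat -> nat -> C) :
  cdominated F -> csum2 F = csum2 (fun i j => F j i).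
Proof.
  intros HF. unfold csum2. f_equal.
  - exact (Series_swap _ (cdominated_Re F HF)).
  - exact (Series_swap _ (cdominated_Im F HF)).
Qed.

Lemma csum2_diagonal (F : nat -> nat -> C) :
  cdominated F ->
  csum2 F = Cplus (csum2 (fun i j => F (i + j)%nat i))
                  (csum2 (fun i j => F i (i + j + 1)%nat)).
Proof.
  intros HF. unfold csum2, Cplus; simpl fst; simpl snd. f_equal.
  - exact (Series2_diagonal _ (cdominated_Re F HF)).
  - exact (Series2_diagonal _ (cdominated_Im F HF)).
Qed.

(** The transposed splitting, in which the diagonal joins the other half. Having both versions lets
    each quadrant be cut with its diagonal on the required side. *)
Lemma csum2_diagonal' (F : nat -> nat -> C) :
  cdominated F ->
  csum2 F = Cplus (csum2 (fun i j => F i (i + j)%nat))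
                  (csum2 (fun i j => F (i + j + 1)%nat i)).
Proof.
  intros HF. rewrite csum2_swap by exact HF.
  exact (csum2_diagonal _ (dominated_swap _ HF)).
Qed.

Lemma csum_antisymmetric (h : Z -> C) (n : Z) :
  (forall s, h (-1 - 2 * n - s)%Z = Copp (h s)) ->
  ex_series (fun j => Cmod (h (Z.of_nat j))) ->
  ex_series (fun j => Cmod (h (-1 - Z.of_nat j)%Z)) ->
  Cplus (csum (fun j => h (Z.of_nat j))) (csum (fun j => h (-1 - Z.of_nat j)%Z)) =
  RtoC 0.
Proof.
  intros Hanti Hp Hn. unfold csum, Cplus, RtoC; simpl fst; simpl snd. f_equal.
  - apply (bilateral_Series_antisymmetric (fun s => Re (h s)) n).
    + intros s. now rewrite Hanti.
    + revert Hp. apply ex_series_le_R. intros j. apply Rabs_Re_le_Cmod.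
    + revert Hn. apply ex_series_le_R. intros j. apply Rabs_Re_le_Cmod.
  - apply (bilateral_Series_antisymmetric (fun s => Im (h s)) n).
    + intros s. now rewrite Hanti.
    + revert Hp. apply ex_series_le_R. intros j. apply Rabs_Im_le_Cmod.
    + revert Hn. apply ex_series_le_R. intros j. apply Rabs_Im_le_Cmod.
Qed.

(** * Sums over the first quadrant minus the third *)

Definition cone_sum (T : Z -> Z -> C) : C :=
  Cminus (csum2 (fun i j => T (Z.of_nat i) (Z.of_nat j)))
         (csum2 (fun i j => T (-1 - Z.of_nat i)%Z (-1 - Z.of_nat j)%Z)).

Lemma hecke_cone_sum (a b c : Z) (x y tau : C) :
  hecke a b c x y tau = cone_sum (hecke_term a b c x y tau).
Proof. reflexivity. Qed.

(* Domination on every quadrant that stays inside [r s >= 0]. *)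
Definition cone_dominated (T : Z -> Z -> C) : Prop :=
  forall k1 d1 k2 d2 : Z, d1 <> 0%Z -> d2 <> 0%Z ->
  (forall i j : nat, 0 <= (k1 + d1 * Z.of_nat i) * (k2 + d2 * Z.of_nat j))%Z ->
  cdominated (fun i j => T (k1 + d1 * Z.of_nat i)%Z (k2 + d2 * Z.of_nat j)%Z).

Lemma cone_dominated_scal (c : C) (T : Z -> Z -> C) :
  cone_dominated T -> cone_dominated (fun r s => Cmult c (T r s)).
Proof.
  intros HT k1 d1 k2 d2 Hd1 Hd2 H.
  now apply (cdominated_scal c), HT.
Qed.

Lemma cone_dominated_quadrant (T : Z -> Z -> C) (k1 d1 k2 d2 : Z)
    (F : nat -> nat -> C) :
  cone_dominated T -> d1 <> 0%Z -> d2 <> 0%Z ->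
  (forall i j : nat, 0 <= (k1 + d1 * Z.of_nat i) * (k2 + d2 * Z.of_nat j))%Z ->
  (forall i j : nat, T (k1 + d1 * Z.of_nat i)%Z (k2 + d2 * Z.of_nat j)%Z = F i j) ->
  cdominated F.
Proof.
  intros HT Hd1 Hd2 H E. eapply cdominated_ext; [exact E | now apply HT].
Qed.

Lemma cone_dominated_nonneg (T : Z -> Z -> C) :
  cone_dominated T -> cdominated (fun i j => T (Z.of_nat i) (Z.of_nat j)).
Proof.
  intros HT. apply (cone_dominated_quadrant T 0 1 0 1); trivial; try lia.
  intros i j; f_equal; lia.
Qed.

Lemma cone_dominated_neg (T : Z -> Z -> C) :
  cone_dominated T ->
  cdominated (fun i j => T (-1 - Z.of_nat i)%Z (-1 - Z.of_nat j)%Z).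
Proof.
  intros HT. apply (cone_dominated_quadrant T (-1) (-1) (-1) (-1)); trivial; lia.
Qed.

Lemma cone_sum_scal (c : C) (T : Z -> Z -> C) :
  cone_dominated T -> cone_sum (fun r s => Cmult c (T r s)) = Cmult c (cone_sum T).
Proof.
  intros HT. unfold cone_sum.
  rewrite (csum2_scal c _ (cone_dominated_nonneg T HT)).
  rewrite (csum2_scal c _ (cone_dominated_neg T HT)). ring.
Qed.

(* [T1] is cut along the diagonal [r = s] into two cones, [T2] along
   [r = s + 1] after moving the row [r = 0] from the first quadrant to the
   third; this costs a bilateral theta sum, which vanishes by [Hrow]. *)
Lemma cone_sum_recombine (T1 T2 G1 G2 : Z -> Z -> C) (n : Z) :
  cone_dominated T1 -> cone_dominated T2 ->
  cone_dominated G1 -> cone_dominated G2 ->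
  (forall r s, G1 (2 * r)%Z s = T1 (r + s)%Z r) ->
  (forall r s, G1 (2 * r + 1)%Z s = T2 (r + 1)%Z (r + s)%Z) ->
  (forall r s, G2 (2 * r)%Z s = Copp (T2 (- r - s)%Z (- r - 1)%Z)) ->
  (forall r s, G2 (2 * r + 1)%Z s = Copp (T1 (-1 - r)%Z (-1 - r - s)%Z)) ->
  (forall s, T2 0%Z (-1 - 2 * n - s)%Z = Copp (T2 0%Z s)) ->
  Cplus (cone_sum T1) (cone_sum T2) = Cplus (cone_sum G1) (cone_sum G2).
Proof.
  intros DT1 DT2 DG1 DG2 E1e E1o E2e E2o Hrow. unfold cone_sum.
  (* [U] is the first quadrant of [T2] without the row [r = 0]; [V] is the third quadrant with that
     row, taken over [s < 0], added. *)
  set (U i j := T2 (Z.of_nat (S i)) (Z.of_nat j)).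
  set (V i j := T2 (- Z.of_nat i)%Z (-1 - Z.of_nat j)%Z).
  assert (DU : cdominated U).
  { apply (cone_dominated_quadrant T2 1 1 0 1); trivial; try lia.
    intros i j. unfold U. f_equal; lia. }
  assert (DV : cdominated V).
  { apply (cone_dominated_quadrant T2 0 (-1) (-1) (-1)); trivial; lia. }
  set (theta_pos := csum (fun j => T2 0%Z (Z.of_nat j))).
  set (theta_neg := csum (fun j => T2 0%Z (-1 - Z.of_nat j)%Z)).
  assert (Htheta : theta_neg = Copp theta_pos).
  { assert (H : Cplus theta_pos theta_neg = RtoC 0).
    { apply (csum_antisymmetric (fun s => T2 0%Z s) n Hrow).
      - exact (dominated_ex_inner _ 0 (cone_dominated_nonneg T2 DT2)).
      - exact (dominated_ex_inner _ 0 DV). }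
    replace theta_neg with (Cminus (Cplus theta_pos theta_neg) theta_pos) by ring.
    rewrite H. ring. }
  assert (HT2 : csum2 (fun i j => T2 (Z.of_nat i) (Z.of_nat j)) =
                Cplus theta_pos (csum2 U)).
  { exact (csum2_first_row _ (cone_dominated_nonneg T2 DT2)). }
  assert (HV : csum2 V =
    Cplus theta_neg (csum2 (fun i j => T2 (-1 - Z.of_nat i)%Z (-1 - Z.of_nat j)%Z))).
  { rewrite (csum2_first_row V DV). f_equal.
    apply csum2_ext. intros i j. unfold V. f_equal. lia. }
  (* The version of the splitting decides which piece holds the boundary. In [T1] the line [r = s]
     goes with [r > s] in both quadrants; in [T2] the line [r = s + 1] goes with [r < s + 1]. *)
  rewrite (csum2_diagonal' U DU) in HT2. rewrite (csum2_diagonal V DV) in HV.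
  rewrite (csum2_diagonal _ (cone_dominated_nonneg T1 DT1)).
  rewrite (csum2_diagonal' _ (cone_dominated_neg T1 DT1)).
  rewrite (csum2_even_odd _ (cone_dominated_nonneg G1 DG1)).
  rewrite (csum2_even_odd _ (cone_dominated_neg G1 DG1)).
  rewrite (csum2_even_odd _ (cone_dominated_nonneg G2 DG2)).
  rewrite (csum2_even_odd _ (cone_dominated_neg G2 DG2)).
  rewrite (csum2_ext (fun i j => G1 (Z.of_nat (2 * i)) (Z.of_nat j))
             (fun i j => T1 (Z.of_nat (i + j)) (Z.of_nat i))).
  2:{ intros i j. replace (Z.of_nat (2 * i)) with (2 * Z.of_nat i)%Z by lia.
      rewrite E1e. f_equal; lia. }
  rewrite (csum2_ext (fun i j => G1 (Z.of_nat (2 * i + 1)) (Z.of_nat j))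
             (fun i j => U i (i + j)%nat)).
  2:{ intros i j.
      replace (Z.of_nat (2 * i + 1)) with (2 * Z.of_nat i + 1)%Z by lia.
      rewrite E1o. unfold U. f_equal; lia. }
  (* In the third quadrant the parities trade places: [-1 - 2i] is odd and [-1 - (2i + 1)] is even,
     so the even-numbered slices fall under the odd identity. *)
  rewrite (csum2_ext
             (fun i j => G1 (-1 - Z.of_nat (2 * i))%Z (-1 - Z.of_nat j)%Z)
             (fun i j => V i (i + j + 1)%nat)).
  2:{ intros i j.
      replace (-1 - Z.of_nat (2 * i))%Z with (2 * (-1 - Z.of_nat i) + 1)%Z by lia.
      rewrite E1o. unfold V. f_equal; lia. }
  rewrite (csum2_ext
             (fun i j => G1 (-1 - Z.of_nat (2 * i + 1))%Z (-1 - Z.of_nat j)%Z)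
             (fun i j => T1 (-1 - Z.of_nat (i + j + 1))%Z (-1 - Z.of_nat i)%Z)).
  2:{ intros i j.
      replace (-1 - Z.of_nat (2 * i + 1))%Z with (2 * (-1 - Z.of_nat i))%Z by lia.
      rewrite E1e. f_equal; lia. }
  rewrite (csum2_ext (fun i j => G2 (Z.of_nat (2 * i)) (Z.of_nat j))
             (fun i j => Copp (V (i + j)%nat i))).
  2:{ intros i j. replace (Z.of_nat (2 * i)) with (2 * Z.of_nat i)%Z by lia.
      rewrite E2e. unfold V. do 2 f_equal; lia. }
  rewrite (csum2_ext (fun i j => G2 (Z.of_nat (2 * i + 1)) (Z.of_nat j))
             (fun i j => Copp (T1 (-1 - Z.of_nat i)%Z (-1 - Z.of_nat (i + j))%Z))).
  2:{ intros i j.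
      replace (Z.of_nat (2 * i + 1)) with (2 * Z.of_nat i + 1)%Z by lia.
      rewrite E2o. do 2 f_equal; lia. }
  rewrite (csum2_ext
             (fun i j => G2 (-1 - Z.of_nat (2 * i))%Z (-1 - Z.of_nat j)%Z)
             (fun i j => Copp (T1 (Z.of_nat i) (Z.of_nat (i + j + 1))))).
  2:{ intros i j.
      replace (-1 - Z.of_nat (2 * i))%Z with (2 * (-1 - Z.of_nat i) + 1)%Z by lia.
      rewrite E2o. do 2 f_equal; lia. }
  rewrite (csum2_ext
             (fun i j => G2 (-1 - Z.of_nat (2 * i + 1))%Z (-1 - Z.of_nat j)%Z)
             (fun i j => Copp (U (i + j + 1)%nat i))).
  2:{ intros i j.
      replace (-1 - Z.of_nat (2 * i + 1))%Z with (2 * (-1 - Z.of_nat i))%Z by lia.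
      rewrite E2e. unfold U. do 2 f_equal; lia. }
  rewrite !csum2_opp, HT2.
  (* Since [theta_neg] is [- theta_pos], the third quadrant of [T2] equals [theta_pos] plus the sum
     of [V]. The first equals [theta_pos] plus the sum of [U], so [theta_pos] cancels in the
     difference. *)
  rewrite Htheta in HV.
  match type of HV with ?x = Cplus _ ?y =>
    replace y with (Cplus theta_pos x) by (rewrite HV; ring) end.
  ring.
Qed.

(** * Powers of [q], signs, and the normal form of a Hecke term *)

Lemma qpow_polar (tau : C) (x : R) :
  qpow tau x =
  (exp (- (2 * PI * Im tau * x)) * cos (2 * PI * Re tau * x),
   exp (- (2 * PI * Im tau * x)) * sin (2 * PI * Re tau * x)).
Proof.
  unfold qpow, cexp.
  set (z := Cmult _ _).
  replace (Re z) with (- (2 * PI * Im tau * x))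
    by (unfold z, Re, Im, Cmult, RtoC, Ci; simpl; ring).
  replace (Im z) with (2 * PI * Re tau * x)
    by (unfold z, Re, Im, Cmult, RtoC, Ci; simpl; ring).
  reflexivity.
Qed.

Lemma qpow_add (tau : C) (x y : R) :
  qpow tau (x + y) = Cmult (qpow tau x) (qpow tau y).
Proof.
  rewrite !qpow_polar, !Rmult_plus_distr_l, Ropp_plus_distr.
  rewrite exp_plus, cos_plus, sin_plus. unfold Cmult; simpl. f_equal; ring.
Qed.

Lemma qpow_0 (tau : C) : qpow tau 0 = RtoC 1.
Proof.
  rewrite qpow_polar, !Rmult_0_r, Ropp_0, exp_0, cos_0, sin_0.
  unfold RtoC. f_equal; ring.
Qed.

Lemma Cmod_qpow (tau : C) (x : R) :
  Cmod (qpow tau x) = exp (- (2 * PI * Im tau * x)).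
Proof.
  rewrite qpow_polar. set (u := exp _). set (v := 2 * PI * Re tau * x).
  unfold Cmod; simpl fst; simpl snd.
  replace ((u * cos v) ^ 2 + (u * sin v) ^ 2)
    with (u ^ 2 * ((sin v)² + (cos v)²)) by (unfold Rsqr; ring).
  rewrite sin2_cos2, Rmult_1_r.
  apply sqrt_pow2. left. apply exp_pos.
Qed.

Lemma qpow_neq_0 (tau : C) (x : R) : qpow tau x <> RtoC 0.
Proof.
  apply Cmod_gt_0. rewrite Cmod_qpow. apply exp_pos.
Qed.

Lemma qpow_opp (tau : C) (x : R) : qpow tau (- x) = Cinv (qpow tau x).
Proof.
  rewrite <- (Cmult_1_r (qpow tau (- x))).
  rewrite <- (Cinv_r (qpow tau x)) by apply qpow_neq_0.
  rewrite Cmult_assoc, <- qpow_add, Rplus_opp_l, qpow_0. apply Cmult_1_l.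
Qed.

Lemma cpow_qpow (tau : C) (x : R) (n : nat) :
  cpow (qpow tau x) n = qpow tau (x * INR n).
Proof.
  induction n as [|n IH].
  - simpl. now rewrite Rmult_0_r, qpow_0.
  - rewrite S_INR. simpl cpow. rewrite IH, <- qpow_add. f_equal. ring.
Qed.

Lemma zpow_qpow (tau : C) (x : R) (n : Z) :
  zpow (qpow tau x) n = qpow tau (x * IZR n).
Proof.
  destruct n as [|p|p]; simpl zpow.
  - now rewrite Rmult_0_r, qpow_0.
  - now rewrite cpow_qpow, INR_IPR.
  - rewrite cpow_qpow, <- qpow_opp, INR_IPR. f_equal.
    change (IZR (Z.neg p)) with (- IPR p). ring.
Qed.

Lemma cpow_mult (x y : C) (n : nat) :
  cpow (Cmult x y) n = Cmult (cpow x n) (cpow y n).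
Proof.
  induction n as [|n IH]; simpl; [|rewrite IH]; ring.
Qed.

Lemma cpow_neq_0 (x : C) (n : nat) : x <> RtoC 0 -> cpow x n <> RtoC 0.
Proof.
  intros Hx. induction n as [|n IH]; simpl.
  - exact C1_nz.
  - now apply Cmult_neq_0.
Qed.

Lemma zpow_mult (x y : C) (n : Z) :
  x <> RtoC 0 -> y <> RtoC 0 -> zpow (Cmult x y) n = Cmult (zpow x n) (zpow y n).
Proof.
  intros Hx Hy. destruct n as [|p|p]; simpl.
  - ring.
  - apply cpow_mult.
  - rewrite cpow_mult. field. split; now apply cpow_neq_0.
Qed.

Lemma sgnC_neq_0 (e : bool) : sgnC e <> RtoC 0.
Proof. destruct e; simpl; intros H; injection H; lra. Qed.

(** With [true] as [+1], multiplication of signs is [eqb]. Sign identities thus become boolean ones,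
    decided by cases. *)
Lemma sgnC_mult (a b : bool) : Cmult (sgnC a) (sgnC b) = sgnC (eqb a b).
Proof.
  destruct a, b; unfold sgnC, Cmult, RtoC; simpl; f_equal; ring.
Qed.

Lemma sgnC_negb (a : bool) : sgnC (negb a) = Copp (sgnC a).
Proof.
  destruct a; unfold sgnC, Copp, RtoC; simpl; f_equal; ring.
Qed.

Lemma sgnC_inv (a : bool) : Cinv (sgnC a) = sgnC a.
Proof.
  destruct a; unfold sgnC, Cinv, RtoC; simpl; f_equal; field.
Qed.

Lemma cpow_sgnC (e : bool) (n : nat) :
  cpow (sgnC e) n = sgnC (e || Nat.even n).
Proof.
  induction n as [|n IH].
  - simpl. now rewrite orb_true_r.
  - simpl cpow. rewrite IH, sgnC_mult, Nat.even_succ, <- Nat.negb_even.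
    now destruct e, (Nat.even n).
Qed.

Lemma zpow_sgnC (e : bool) (n : Z) : zpow (sgnC e) n = sgnC (e || Z.even n).
Proof.
  assert (Hpos : forall p, Nat.even (Pos.to_nat p) = Z.even (Z.pos p)).
  { intros p. rewrite <- positive_nat_Z. symmetry.
    apply eq_true_iff_eq. rewrite Z.even_spec, Nat.even_spec.
    split; intros [k Hk]; [exists (Z.to_nat k) | exists (Z.of_nat k)]; lia. }
  destruct n as [|p|p]; unfold zpow.
  - simpl. now rewrite orb_true_r.
  - now rewrite cpow_sgnC, Hpos.
  - now rewrite cpow_sgnC, sgnC_inv, Hpos.
Qed.

(** One of [r], [r - 1] is even, so the integer division is exact for negative [r] as well. *)
Lemma IZR_binZ2 (r : Z) : IZR (binZ2 r) = IZR r * (IZR r - 1) / 2.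
Proof.
  assert (H : (2 * binZ2 r = r * (r - 1))%Z).
  { unfold binZ2. destruct (Z.Even_or_Odd r) as [[k ->]|[k ->]].
    - replace (2 * k * (2 * k - 1))%Z with (k * (2 * k - 1) * 2)%Z by ring.
      rewrite Z.div_mul by lia. ring.
    - replace ((2 * k + 1) * (2 * k + 1 - 1))%Z with ((2 * k + 1) * k * 2)%Z by ring.
      rewrite Z.div_mul by lia. ring. }
  apply (f_equal IZR) in H. rewrite !mult_IZR, minus_IZR in H. lra.
Qed.

(** Normal form: one sign times one power of [q]. Comparing two terms then amounts to comparing a
    boolean and a real exponent. *)
Lemma hecke_term_qpow (a b c : Z) (e : bool) (x y : R) (tau : C) (r s : Z) :
  hecke_term a b c (Cmult (sgnC e) (qpow tau x)) (qpow tau y) tau r s =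
  Cmult (sgnC (eqb (Z.even (r + s)) (e || Z.even r)))
    (qpow tau (x * IZR r + y * IZR s + IZR a * (IZR r * (IZR r - 1) / 2)
               + IZR b * IZR r * IZR s + IZR c * (IZR s * (IZR s - 1) / 2))).
Proof.
  unfold hecke_term. change (RtoC (-1)) with (sgnC false).
  rewrite zpow_mult by (apply sgnC_neq_0 || apply qpow_neq_0).
  rewrite !zpow_sgnC, !zpow_qpow, <- sgnC_mult.
  rewrite !plus_IZR, !mult_IZR, !IZR_binZ2, !qpow_add. simpl orb. ring.
Qed.

Lemma monomial_mult (tau : C) (e1 e2 : bool) (x1 x2 : R) :
  Cmult (Cmult (sgnC e1) (qpow tau x1)) (Cmult (sgnC e2) (qpow tau x2)) =
  Cmult (sgnC (eqb e1 e2)) (qpow tau (x1 + x2)).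
Proof. rewrite <- sgnC_mult, qpow_add. ring. Qed.

Lemma monomial_opp (tau : C) (e : bool) (x : R) :
  Copp (Cmult (sgnC e) (qpow tau x)) = Cmult (sgnC (negb e)) (qpow tau x).
Proof. rewrite sgnC_negb. ring. Qed.

(** * Gaussian bounds and absolute convergence *)

Lemma pow_exp (x : R) (n : nat) : exp x ^ n = exp (x * INR n).
Proof.
  induction n as [|n IH].
  - now rewrite Rmult_0_r, exp_0.
  - rewrite S_INR. simpl pow. rewrite IH, <- exp_plus. f_equal. ring.
Qed.

(** Ratio test: consecutive terms have ratio [exp (- (A + B)) * exp (- (2 * A)) ^ n], which tends to
    zero. *)
Lemma ex_series_gaussian (A B D : R) :
  0 < A -> ex_series (fun n => exp (- (A * INR n ^ 2 + B * INR n + D))).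
Proof.
  intros HA.
  set (u n := exp (- (A * INR n ^ 2 + B * INR n + D))).
  apply (ex_series_ext (fun n => Rabs (u n))).
  { intros n. apply Rabs_pos_eq. left. apply exp_pos. }
  apply (ex_series_DAlembert u 0).
  - lra.
  - intros n. apply Rgt_not_eq, exp_pos.
  - apply is_lim_seq_ext with (fun n => exp (- (A + B)) * exp (- (2 * A)) ^ n).
    + intros n. rewrite <- (Rabs_pos_eq (exp (- (A + B)) * exp (- (2 * A)) ^ n)).
      * f_equal. unfold u, Rdiv. rewrite <- exp_Ropp, <- exp_plus, S_INR.
        rewrite pow_exp, <- exp_plus. f_equal. ring.
      * left. apply Rmult_lt_0_compat; [|apply pow_lt]; apply exp_pos.
    + replace (Finite 0) with (Rbar_mult (exp (- (A + B))) 0)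
        by (simpl; f_equal; ring).
      apply is_lim_seq_scal_l, is_lim_seq_geom.
      rewrite Rabs_pos_eq by (left; apply exp_pos).
      rewrite <- exp_0. apply exp_increasing. lra.
Qed.

(** Along the progression [k + d * n] the exponent is again quadratic in [n], with leading
    coefficient [t * a * d ^ 2 / 2 > 0]. *)
Lemma ex_series_gaussian_Z (t a x : R) (k d : Z) :
  0 < t -> 0 < a -> d <> 0%Z ->
  ex_series (fun n => let r := IZR (k + d * Z.of_nat n) in
                      exp (- (t * (x * r + a * (r * (r - 1) / 2))))).
Proof.
  intros Ht Ha Hd.
  assert (Hd2 : 0 < IZR d * IZR d).
  { rewrite <- mult_IZR. apply IZR_lt. nia. }
  set (kR := IZR k). set (dR := IZR d).
  eapply ex_series_ext;
    [|apply (ex_series_gaussian (t * a * (dR * dR) / 2)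
        (t * (x * dR + a * (dR * (2 * kR - 1) / 2)))
        (t * (x * kR + a * (kR * (kR - 1) / 2))))].
  - intros n. cbv zeta. rewrite plus_IZR, mult_IZR, <- INR_IZR_INZ.
    f_equal. unfold kR, dR. field.
  - unfold dR. apply Rdiv_lt_0_compat; [|lra].
    apply Rmult_lt_0_compat; [now apply Rmult_lt_0_compat | exact Hd2].
Qed.

Lemma Cmod_sgnC (e : bool) : Cmod (sgnC e) = 1.
Proof.
  destruct e; simpl; rewrite Cmod_R; [apply Rabs_R1|].
  rewrite Rabs_left; lra.
Qed.

(** Where [r * s >= 0], the cross term [b * r * s] can only decrease the modulus. Dropping it leaves
    a product of two one-variable Gaussians. *)
Lemma hecke_term_dominated (a b c : Z) (e : bool) (x y : R) (tau : C) :
  (0 < a)%Z -> (0 <= b)%Z -> (0 < c)%Z -> 0 < Im tau ->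
  cone_dominated
    (hecke_term a b c (Cmult (sgnC e) (qpow tau x)) (qpow tau y) tau).
Proof.
  intros Ha Hb Hc Htau k1 d1 k2 d2 Hd1 Hd2 Hcone.
  apply IZR_lt in Ha, Hc. apply IZR_le in Hb.
  assert (Ht : 0 < 2 * PI * Im tau).
  { pose proof PI_RGT_0. apply Rmult_lt_0_compat; lra. }
  set (t := 2 * PI * Im tau) in *.
  exists (fun n => let r := IZR (k1 + d1 * Z.of_nat n) in
            exp (- (t * (x * r + IZR a * (r * (r - 1) / 2))))).
  exists (fun n => let s := IZR (k2 + d2 * Z.of_nat n) in
            exp (- (t * (y * s + IZR c * (s * (s - 1) / 2))))).
  split; [now apply ex_series_gaussian_Z|].
  split; [now apply ex_series_gaussian_Z|].
  intros i j. cbv zeta.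
  rewrite hecke_term_qpow, Cmod_mult, Cmod_sgnC, Cmod_qpow.
  rewrite Rabs_pos_eq by (rewrite Rmult_1_l; left; apply exp_pos).
  rewrite Rmult_1_l, <- exp_plus. fold t.
  specialize (Hcone i j). apply IZR_le in Hcone. rewrite mult_IZR in Hcone.
  set (r := IZR (k1 + _)) in *. set (s := IZR (k2 + _)) in *.
  assert (H : 0 <= t * (IZR b * (r * s))).
  { apply Rmult_le_pos; [lra | now apply Rmult_le_pos]. }
  match goal with |- exp ?u <= exp ?v =>
    assert (Huv : u <= v) by nra;
    destruct Huv as [Huv | ->]; [left; now apply exp_increasing | right] end.
  reflexivity.
Qed.

(* pm = true : the "+" sign; pm = false : the "-" sign *)
Theorem theorem1p1 (K : nat) (m l : Z) (tau : C) (pm : bool) :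
  (0 < K)%nat ->
  (0 <= l <= 2 * Z.of_nat K)%Z ->
  ((m - l) mod 2 = 0)%Z ->
  0 < Im tau ->
  Cplus (string_fn (2 * K) m l tau)
        (Cmult (sgnC pm) (string_fn (2 * K) (2 * Z.of_nat K - m) l tau))
  = Cmult (Cdiv (qpow tau (sML m l (2 * K))) (cpow (J1 tau) 3))
      (Cplus
         (hecke (Z.of_nat K + 1) (Z.of_nat K + 1) 1
            (Cmult (sgnC pm) (qpow tau (1 + (INR K + IZR l) / 2)))
            (qpow tau (1 + (IZR m + IZR l) / 2)) tau)
         (Cmult (Cmult (sgnC pm) (qpow tau ((INR K - IZR l) / 2)))
            (hecke (Z.of_nat K + 1) (Z.of_nat K + 1) 1
               (Cmult (sgnC pm) (qpow tau (1 + (3 * INR K - IZR l) / 2)))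
               (qpow tau (1 + INR K + (IZR m - IZR l) / 2)) tau))).
Proof.
  intros HK _ Hpar Htau.
  assert (HKR : INR K <> 0) by (apply not_0_INR; lia).
  (* Writing [m = l + 2 * n] turns the parity condition into an integer parameter. *)
  assert (Hm : exists n, (m = l + 2 * n)%Z).
  { exists ((m - l) / 2)%Z. pose proof (Z.div_mod (m - l) 2). lia. }
  destruct Hm as [n ->].
  set (a := Z.of_nat K) in *.
  assert (Ha : INR K = IZR a) by apply INR_IZR_INZ.
  assert (HN : (1 + Z.of_nat (2 * K) = 1 + 2 * a)%Z) by lia.
  unfold string_fn. rewrite HN.
  (* With [m' = 2K - m] the two exponents differ by [(m ^ 2 - m' ^ 2) / (8K) = (m - K) / 2]. *)
  replace (sML (2 * a - (l + 2 * n)) l (2 * K))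
    with (sML (l + 2 * n) l (2 * K) + (IZR l + 2 * IZR n - IZR a) / 2).
  2:{ unfold sML. rewrite minus_IZR, plus_IZR, !mult_IZR, mult_INR, <- Ha.
      simpl INR. field. pose proof (pos_INR K). split; lra. }
  rewrite (qpow_add _ (sML _ _ _)), !hecke_cone_sum, !Ha.
  (* A trivial sign [+1] brings the left-hand terms to the shape that [hecke_term_qpow] expects. *)
  rewrite <- (Cmult_1_l (qpow tau (1 + (IZR (l + 2 * n) + IZR l) / 2))) at 1.
  rewrite <- (Cmult_1_l (qpow tau (1 + (IZR (2 * a - (l + 2 * n)) + IZR l) / 2))).
  change (RtoC 1) with (sgnC true).
  set (T1 := hecke_term 1 (1 + 2 * a) 1
    (Cmult (sgnC true) (qpow tau (1 + (IZR (l + 2 * n) + IZR l) / 2)))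
    (qpow tau (1 - (IZR (l + 2 * n) - IZR l) / 2)) tau).
  set (T2 := hecke_term 1 (1 + 2 * a) 1
    (Cmult (sgnC true) (qpow tau (1 + (IZR (2 * a - (l + 2 * n)) + IZR l) / 2)))
    (qpow tau (1 - (IZR (2 * a - (l + 2 * n)) - IZR l) / 2)) tau).
  set (G1 := hecke_term (a + 1) (a + 1) 1
    (Cmult (sgnC pm) (qpow tau (1 + (IZR a + IZR l) / 2)))
    (qpow tau (1 + (IZR (l + 2 * n) + IZR l) / 2)) tau).
  set (G2 := hecke_term (a + 1) (a + 1) 1
    (Cmult (sgnC pm) (qpow tau (1 + (3 * IZR a - IZR l) / 2)))
    (qpow tau (1 + IZR a + (IZR (l + 2 * n) - IZR l) / 2)) tau).
  set (c := Cmult (sgnC pm) (qpow tau ((IZR l + 2 * IZR n - IZR a) / 2))).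
  set (d := Cmult (sgnC pm) (qpow tau ((IZR a - IZR l) / 2))).
  assert (DT1 : cone_dominated T1) by (apply hecke_term_dominated; lia || trivial).
  assert (DT2 : cone_dominated T2) by (apply hecke_term_dominated; lia || trivial).
  assert (DG1 : cone_dominated G1) by (apply hecke_term_dominated; lia || trivial).
  assert (DG2 : cone_dominated G2) by (apply hecke_term_dominated; lia || trivial).
  assert (Key : Cplus (cone_sum T1) (Cmult c (cone_sum T2)) =
                Cplus (cone_sum G1) (Cmult d (cone_sum G2))).
  { rewrite <- (cone_sum_scal c T2 DT2), <- (cone_sum_scal d G2 DG2).
    (* The row [r = 0] of [T2] has exponent [(1 + N) s + s (s - 1) / 2] with [N = l + n - a]. It is
       invariant under [s -> -1 - 2N - s], which flips the parity of [s] and hence the sign. *)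
    apply (cone_sum_recombine _ _ _ _ (l + n - a)); trivial;
      try (now apply cone_dominated_scal); intros;
      unfold T1, T2, G1, G2, c, d; rewrite !hecke_term_qpow.
    (* Each of the five remaining identities splits into an equality of signs, settled by cases on
       parities and [pm], and an equality of exponents, settled by [field]. *)
    all: rewrite ?monomial_mult, ?monomial_opp; f_equal.
    all: repeat rewrite ?Z.even_add, ?Z.even_sub, ?Z.even_opp, ?Z.even_mul; f_equal.
    all: simpl Z.even.
    all: try (repeat match goal with |- context [Z.even ?x] => destruct (Z.even x) end;
           destruct pm; reflexivity).
    all: repeat rewrite ?plus_IZR, ?minus_IZR, ?opp_IZR, ?mult_IZR; field. }
  rewrite <- Key. unfold c, Cdiv. ring.
Qed.
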